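(* Let $(X,X_+,\mathcal K,f)$ be an abstract state space and let $\mathcal S=(S_t)_{t\ge0}$, $\mathcal T=(T_t)_{t\ge0}$ be $C_0$-Markov semigroups on $X$ with generators $A$ and $C$, respectively, such that $A$ and $C$ have the same domain and $B:=C-A$ is bounded (i.e. extends to a bounded linear operator on $X$, again denoted $B$). Suppose there exist $\rho\in[0,1)$ and $t_0>0$ such that $\delta(T_{t_0})\le\rho$. Then for every $x,z\in\mathcal K$, $$\sup_{t\ge0}\|T_tx-S_tz\|\le\|x-z\|+\frac{t_0}{1-\rho}\|B\|.$$ In addition, let $x_0\in\mathcal K$ be the element with $\lim_{t\to\infty}\|T_t-T_{x_0}\|=0$ (which exists because $\delta(T_{t_0})<1$). If $\mathcal S$ is uniformly asymptotically stable to $S_{z_0}$, i.e. $z_0\in\mathcal K$ and $\lim_{t\to\infty}\|S_t-S_{z_0}\|=0$, then $$\|T_{x_0}-S_{z_0}\|\le\frac{t_0}{1-\rho}\|B\|.$$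
   Context: Abstract state space $(X,X_+,\mathcal K,f)$: $X$ is a real vector space ordered by a generating cone $X_+$ (so $X=X_+-X_+$), $f$ is a linear functional on $X$ with $f(x)>0$ for all $x\in X_+\setminus\{0\}$, and $\mathcal K=\{x\in X_+: f(x)=1\}$. Let $U$ be the convex hull of $\mathcal K\cup(-\mathcal K)$ and $\|x\|=\inf\{\lambda\ge0: x\in\lambda U\}$. It is assumed that $\|\cdot\|$ is a norm, that $X$ is complete for it, and that $X_+$ is closed. Norms of operators are operator norms. A linear operator $T:X\to X$ is Markov if it is positive ($Tx\ge0$ whenever $x\ge 0$) and $T(\mathcal K)\subset\mathcal K$. A $C_0$-Markov semigroup is a strongly continuous one-parameter semigroup $(T_t)_{t\ge0}$ on $X$ ($T_0=I$, $T_{t+s}=T_tT_s$, $\|T_tx-x\|\to0$ as $t\downarrow0$ for every $x\in X$) such that every $T_t$ is Markov. For $x_0,z_0\in X$, $T_{x_0}$ and $S_{z_0}$ denote the operators $T_{x_0}(x)=f(x)x_0$ and $S_{z_0}(x)=f(x)z_0$ on $X$ (not to be confused with the semigroup operators $T_t,S_t$, $t\ge0$). Dobrushin's ergodicity coefficient of a Markov operator $T$: with $N=\{x\in X: f(x)=0\}$, $\delta(T)=\sup_{x\in N,\,x\ne0}\|Tx\|/\|x\|$. *)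

(* Defs.v *)
From HB Require Import structures.
From mathcomp Require Import all_boot all_order all_algebra.
From mathcomp Require Import all_classical all_reals all_analysis.

Set Implicit Arguments.
Unset Strict Implicit.
Unset Printing Implicit Defensive.

Import Order.TTheory GRing.Theory Num.Theory.
Import numFieldNormedType.Exports.

Local Open Scope classical_set_scope.
Local Open Scope ring_scope.

Section StateSpace.
Context {R : realType} {X : lmodType R}.

Definition is_cone (P : set X) : Prop :=
  [/\ P 0,
      forall x y, P x -> P y -> P (x + y),
      forall (l : R) x, 0 <= l -> P x -> P (l *: x) &
      forall x, P x -> P (- x) -> x = 0].

Definition generating (P : set X) : Prop :=
  forall x, exists a b, [/\ P a, P b & x = a - b].

Definition convex_hull (E : set X) : set X := smallest (@convex_set R X) E.

Definition base (P : set X) (f : {scalar X}) : set X :=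
  [set x | P x /\ f x = 1].

Definition base_ball (P : set X) (f : {scalar X}) : set X :=
  convex_hull (base P f `|` [set - x | x in base P f]).

(* Valued in \bar R so that the infimum over the empty set is +oo. *)
Definition base_gauge (P : set X) (f : {scalar X}) (x : X) : \bar R :=
  ereal_inf [set l%:E |
    l in [set l : R | 0 <= l /\ exists2 u, base_ball P f u & x = l *: u]].

End StateSpace.

(* The norm and topology of X are those of the library structure;
   [ass_norm] says that this norm is the gauge of the base ball. It rules out
   X = 0, whose base is empty and whose gauge is therefore +oo. *)
Record abstract_state_space (R : realType) (X : completeNormedModType R)
    (P : set X) (f : {scalar X}) : Prop := AbstractStateSpace {
  ass_cone : is_cone P;
  ass_generating : generating P;
  ass_pos : forall x, P x -> x != 0 -> 0 < f x;
  ass_norm : forall x : X, (`|x|)%:E = base_gauge P f x;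
  ass_closed : closed P }.

Section Operators.
Context {R : realType} {X : completeNormedModType R}.
Implicit Types (P : set X) (f : {scalar X}).

(* A real supremum: it is the operator norm only for bounded T (Markov operators,
   f(.)x0 and their differences are bounded); for unbounded T it is 0. *)
Definition opnorm (T : X -> X) : R :=
  sup [set `|T x| | x in [set x : X | `|x| <= 1]].

Definition markov P f (T : {linear X -> X}) : Prop :=
  (forall x, P x -> P (T x)) /\ (forall x, base P f x -> base P f (T x)).

(* The set of ratios is bounded by 1 when T is Markov; when f has kernel 0 the
   set is empty and the value is 0. *)
Definition dobrushin f (T : {linear X -> X}) : R :=
  sup [set `|T x| / `|x| | x in [set x : X | f x = 0 /\ x != 0]].

(* The values of T at negative times are irrelevant. *)
Definition C0_semigroup (T : R -> {linear X -> X}) : Prop :=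
  [/\ forall x, T 0 x = x,
      forall s t x, 0 <= s -> 0 <= t -> T (t + s) x = T t (T s x) &
      forall x, `|T t x - x| @[t --> 0^'+] --> (0 : R)].

Definition C0_markov_semigroup P f (T : R -> {linear X -> X}) : Prop :=
  C0_semigroup T /\ forall t, 0 <= t -> markov P f (T t).

Definition diff_quotient (T : R -> {linear X -> X}) (x : X) (t : R) : X :=
  t^-1 *: (T t x - x).

Definition generator_dom (T : R -> {linear X -> X}) : set X :=
  [set x | cvg (diff_quotient T x t @[t --> 0^'+])].

(* Meaningful only on [generator_dom T]. *)
Definition generator (T : R -> {linear X -> X}) (x : X) : X :=
  lim (diff_quotient T x t @[t --> 0^'+]).

(* T_{x0} (and S_{x0}) : x |-> f(x) x0 *)
Definition rank1 f (x0 x : X) : X := f x *: x0.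

Definition uniformly_stable_to P f (T : R -> {linear X -> X}) (x0 : X) : Prop :=
  base P f x0 /\
  opnorm (fun x => T t x - rank1 f x0 x) @[t --> +oo] --> (0 : R).

End Operators.

(* Main.v *)
(**
  The Dyson perturbation bound |T_t z - S_t z| <= t |B| |z| is obtained without
  vector-valued integrals. For z in the common domain of the generators, the
  function t |-> |T_t z - S_t z| has upper right derivative at most |B| |z|, and
  the domain is dense because the means (1/N) sum_{k<N} S_(ck/N) z converge to
  elements of the domain, which tend to z as c tends to 0.

  Since T_t0 contracts the kernel of f by rho, splitting off one step of length
  t0 through T_t z - S_t z = T_t0 (T_s z - S_s z) + (T_t0 - S_t0) S_s z, with
  t = t0 + s, propagates the bound E = t0 |B| / (1 - rho), the fixed point of
  E = rho E + t0 |B|. The element x0 is the limit of T_(n t0) k for any k in K,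
  because T_(n t0) maps K to a set of diameter at most 2 rho^n.
*)

Require Import Defs.
From HB Require Import structures.
From mathcomp Require Import all_boot all_order all_algebra.
From mathcomp Require Import all_classical all_reals all_analysis.
From mathcomp Require Import ring lra.

Set Implicit Arguments.
Unset Strict Implicit.
Unset Printing Implicit Defensive.

Import Order.TTheory GRing.Theory Num.Theory.
Import numFieldNormedType.Exports.

Local Open Scope classical_set_scope.
Local Open Scope ring_scope.

(** * The base norm: estimates tested on the base, and closedness of the base *)

Section BaseNorm.
Context {R : realType} {X : completeNormedModType R}.
Variables (P : set X) (f : {scalar X}).
Hypothesis hX : abstract_state_space P f.

(** The empty set is convex, so an empty base would have an empty hull, and the gauge of 0 would be
    [+oo] instead of a norm. *)
Lemma base_nonempty : base P f !=set0.
Proof.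
apply: contrapT => K0.
have U0 u : ~ base_ball P f u.
  move=> /(_ set0); apply; split; first by move=> x y l; rewrite inE.
  by move=> x [Kx|[y Ky _]]; apply: K0; [exists x | exists y].
have : (`|0 : X|)%:E = base_gauge P f 0 := ass_norm hX 0.
rewrite (_ : base_gauge _ _ _ = +oo%E) //.
rewrite /base_gauge (_ : [set _ | _] = set0) ?image_set0 ?ereal_inf0 //.
by apply/seteqP; split=> // l /= [_ [u /U0]].
Qed.

Lemma base_ball_base (x : X) : base P f x -> base_ball P f x.
Proof. by move=> Kx A [_]; apply; left. Qed.

(** The sublevel set of [q] at [c] is convex and contains the base and its negative, hence the whole
    base ball; then [x] is written as [l *: u] with [l] close to the norm of [x]. *)
Lemma base_seminorm_le (q : X -> R) (c : R) : 0 <= c ->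
  (forall l x, q (l *: x) = `|l| * q x) ->
  (forall x y, q (x + y) <= q x + q y) ->
  (forall x, base P f x -> q x <= c) ->
  forall x, q x <= c * `|x|.
Proof.
move=> c0 qZ qD qK.
have qU u : base_ball P f u -> q u <= c.
  move=> /(_ [set u | q u <= c]); apply; split; last first.
    move=> x [/qK//|[y /qK qy <-]] /=.
    by rewrite -scaleN1r qZ normrN1 mul1r.
  move=> x y l; rewrite !inE /= => qx qy.
  apply: (le_trans (qD _ _)); rewrite !qZ.
  have l0 : 0 <= l%:num by [].
  have l1 : l%:num <= 1 by [].
  rewrite /unstable.onem !ger0_norm ?subr_ge0 //.
  have := ler_wpM2l l0 qx.
  have l1' : 0 <= 1 - l%:num by rewrite subr_ge0.
  by have := ler_wpM2l l1' qy; lra.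
move=> x; apply/ler_addgt0Pr => e e0.
(* Since [c] may be 0, the slack is divided by [c + 1]. *)
have c10 : 0 < c + 1 by lra.
have := @lb_ereal_inf_adherent R [set l%:E |
    l in [set l : R | 0 <= l /\ exists2 u, base_ball P f u & x = l *: u]]
  (e / (c + 1)) (divr_gt0 e0 c10).
rewrite -[ereal_inf _]/(base_gauge P f x) -(ass_norm hX) => /(_ isT).
move=> [_ [l [l0 [u /qU qu ->]] <-]]; rewrite -EFinD lte_fin => lx.
rewrite qZ ger0_norm //.
apply: (@le_trans _ _ (l * c)); first exact: ler_wpM2l.
apply: (@le_trans _ _ (c * (`|l *: u| + e / (c + 1)))).
  by rewrite mulrC ler_wpM2l // ltW.
rewrite mulrDr lerD2l mulrCA ler_piMr ?(ltW e0) //.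
by rewrite ler_pdivrMr // mul1r lerDl.
Qed.

Lemma state_functional_le (x : X) : `|f x| <= `|x|.
Proof.
rewrite -[leRHS]mul1r; apply: (base_seminorm_le (q := fun x => `|f x|)) => //.
- by move=> l y; rewrite linearZ normrM.
- by move=> y z; rewrite linearD ler_normD.
- by move=> y [_ ->]; rewrite normr1.
Qed.

Lemma base_norm (x : X) : base P f x -> `|x| = 1.
Proof.
move=> Kx; apply/eqP; rewrite eq_le; apply/andP; split; last first.
  by case: Kx (state_functional_le x) => _ ->; rewrite normr1.
rewrite -lee_fin (ass_norm hX); apply: ereal_inf_lbound.
by exists 1 => //; split => //; exists x; rewrite ?scale1r //; exact: base_ball_base.
Qed.

Lemma closed_base : closed (base P f).
Proof.
have fc : continuous (f : X -> R).
  move=> x; apply/cvgrPdist_le => e e0; near=> y.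
  rewrite -linearB; apply: le_trans (state_functional_le _) _.
  by near: y; apply: cvgr_dist_le.
rewrite (_ : base P f = P `&` f @^-1` [set 1]) //.
apply: closedI (ass_closed hX) _.
by move/continuous_closedP: fc; apply; exact: closed_eq.
Unshelve. all: by end_near. Qed.

End BaseNorm.

(** * Markov operators and the real-valued operator norm *)

Section Operators.
Context {R : realType} {X : completeNormedModType R}.
Variables (P : set X) (f : {scalar X}).
Hypothesis hX : abstract_state_space P f.
Implicit Types T L : {linear X -> X}.

(** Dividing a nonzero cone element by its value under [f] puts it in the base, which [T] preserves;
    the cone generates X, so linearity does the rest. *)
Lemma markov_functional T : Defs.markov P f T -> forall x, f (T x) = f x.
Proof.
move=> [TP TK] x.
have fP y : P y -> f (T y) = f y.
  move=> Py; have [->|y0] := eqVneq y 0; first by rewrite !linear0.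
  have fy : 0 < f y := ass_pos hX Py y0.
  have fV : 0 <= (f y)^-1 by rewrite invr_ge0 ltW.
  have /TK[_] : base P f ((f y)^-1 *: y).
    split; last by rewrite linearZ /= mulVf ?gt_eqF.
    by have [_ _ PZ _] := ass_cone hX; exact: PZ.
  by rewrite !linearZ /= => /(canRL (mulVKf (lt0r_neq0 fy))); rewrite mulr1.
have [a [b [Pa Pb ->]]] := ass_generating hX x.
by rewrite !linearB !fP.
Qed.

Lemma markov_contraction T : Defs.markov P f T -> forall x, `|T x| <= `|x|.
Proof.
move=> [_ TK] x; rewrite -[leRHS]mul1r.
apply: (base_seminorm_le hX (q := fun x => `|T x|)) => //.
- by move=> l y; rewrite linearZ normrZ.
- by move=> y z; rewrite linearD ler_normD.
- by move=> y /TK /(base_norm hX) ->.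
Qed.

Lemma dobrushin_bound T : Defs.markov P f T ->
  forall x, f x = 0 -> `|T x| <= dobrushin f T * `|x|.
Proof.
move=> mT x fx; have [->|x0] := eqVneq x 0; first by rewrite linear0 !normr0 mulr0.
rewrite -ler_pdivrMr ?normr_gt0 //; apply: ub_le_sup; last by exists x.
exists 1 => _ [y [_ y0] <-].
by rewrite ler_pdivrMr ?normr_gt0 // mul1r; exact: markov_contraction.
Qed.

(** The constant [c] only certifies boundedness: the real supremum of an unbounded set takes the
    default value 0. *)
Lemma opnorm_ub (L : X -> X) (c : R) :
  (forall x, `|x| <= 1 -> `|L x| <= c) ->
  forall x, `|x| <= 1 -> `|L x| <= opnorm L.
Proof.
move=> Lc x x1; apply: ub_le_sup; last by exists x.
by exists c => _ [y /= y1 <-]; exact: Lc.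
Qed.

Lemma opnorm_le (L : X -> X) (c : R) :
  (forall x, `|x| <= 1 -> `|L x| <= c) -> opnorm L <= c.
Proof.
move=> Lc; apply: ge_sup; last by move=> _ [y /= y1 <-]; exact: Lc.
by exists `|L 0|, 0 => //=; rewrite normr0.
Qed.

Lemma opnorm_linear L : bounded_near L (nbhs (0 : X)) ->
  0 <= opnorm L /\ forall x, `|L x| <= opnorm L * `|x|.
Proof.
move=> /linear_boundedP [M [_ /(_ (M + 1))]]; rewrite ltrDl ltr01 => /(_ isT) LM.
have {LM} L1 x : `|x| <= 1 -> `|L x| <= `|M + 1|.
  move=> x1; apply: (le_trans (LM x)); apply: (@le_trans _ _ (`|M + 1| * `|x|)).
    by rewrite ler_wpM2r // ler_norm.
  by rewrite ler_piMr.
have opL := opnorm_ub L1.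
have L0 : 0 <= opnorm L by apply: le_trans (opL 0 _); rewrite ?normr0.
split=> // x; have [->|x0] := eqVneq x 0; first by rewrite linear0 !normr0 mulr0.
have nx : 0 < `|x| by rewrite normr_gt0.
have := opL (`|x|^-1 *: x).
rewrite linearZ !normrZ normfV normr_id mulVf ?gt_eqF // => /(_ (lexx _)).
by rewrite ler_pdivrMl // mulrC.
Qed.

End Operators.

(** * A one-sided growth criterion for real functions *)

Section RightDerivative.
Context {R : realType}.

Lemma near0_right_ex (Q : R -> Prop) : (\forall t \near 0^'+, Q t) ->
  exists2 d : R, 0 < d & forall t, 0 < t <= d -> Q t.
Proof.
move=> [/= d d0 Qd]; exists (d / 2); first by rewrite divr_gt0.
move=> t /andP[t0 td]; apply: Qd => //=.
by rewrite sub0r normrN gtr0_norm //; lra.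
Qed.

Lemma near0_right_intro (Q : R -> Prop) (d : R) : 0 < d ->
  (forall t, 0 < t <= d -> Q t) -> \forall t \near 0^'+, Q t.
Proof.
move=> d0 Qd; exists d => //= t /=; rewrite sub0r normrN => td t0.
by apply: Qd; rewrite t0 /= ltW // (le_lt_trans (ler_norm t)).
Qed.

(** Continuation with slope [M + e]: lower semicontinuity from the left puts the supremum of the
    good times into the set of good times, and the right estimate moves past it unless it equals
    [t]. Then [e] tends to 0. *)
Lemma le_of_right_derivative_le (g : R -> R) (M t : R) : 0 <= M -> 0 <= t ->
  (forall s e, 0 <= s -> 0 < e -> exists2 d, 0 < d &
     forall h, 0 < h <= d -> g (s + h) <= g s + h * (M + e)) ->
  (forall s e, 0 <= s -> 0 < e -> exists2 d, 0 < d &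
     forall r, 0 <= r <= s -> s - d <= r -> g s <= g r + e) ->
  g t <= g 0 + t * M.
Proof.
move=> M0 t0 gR gL.
suff gE e : 0 < e -> g t <= g 0 + t * (M + e).
  apply/ler_addgt0Pr => e e0.
  have t1 : 0 < t + 1 by lra.
  apply: (le_trans (gE _ (divr_gt0 e0 t1))).
  rewrite mulrDr addrA lerD2l mulrCA ler_piMr ?(ltW e0) //.
  by rewrite ler_pdivrMr // mul1r lerDl.
move=> e0; have Me : 0 <= M + e by lra.
pose E := [set s | 0 <= s <= t /\ g s <= g 0 + s * (M + e)].
have E0 : E 0 by rewrite /E /= lexx t0 mul0r addr0.
have Eub : ubound E t by move=> s [/andP[]].
have hsE : has_sup E by split; [exists 0 | exists t].
have tau0 : 0 <= sup E by apply: ub_le_sup => //; exists t.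
have taut : sup E <= t by apply: ge_sup => //; exists 0.
have Etau : E (sup E).
  split; first by rewrite tau0.
  apply/ler_addgt0Pr => eta eta0.
  have [d d0 gd] := gL _ _ tau0 eta0.
  have [r [/andP[r0 rt] gr] dr] := sup_adherent d0 hsE.
  have rtau : r <= sup E by apply: ub_le_sup; [exists t | split=> //; rewrite r0].
  apply: (le_trans (gd r _ (ltW dr))); first by rewrite r0.
  have := ler_wpM2r Me rtau; lra.
have [tt|tt] := ltP (sup E) t; last first.
  by have -> : t = sup E by [apply/eqP; rewrite eq_le tt taut]; case: Etau.
have [d d0 gd] := gR _ _ tau0 e0.
(* Cutting the step off at [t - sup E] keeps [sup E + h] inside [E], which contradicts the
   supremum. *)
have h0 : 0 < Num.min d (t - sup E) by rewrite lt_min d0 subr_gt0.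
have hd : Num.min d (t - sup E) <= d by rewrite ge_min lexx.
have ht : Num.min d (t - sup E) <= t - sup E by rewrite ge_min lexx orbT.
set h := Num.min _ _ in h0 hd ht.
suff : sup E + h <= sup E by lra.
apply: ub_le_sup; first by exists t.
split; first by lra.
case: Etau => _ gtau.
by apply: (le_trans (gd h _)); [rewrite h0 | lra].
Qed.

End RightDerivative.

Lemma norm_sum_le (R : realType) (V : normedModType R) (n : nat)
    (F : nat -> V) (c : R) :
  (forall k, (k < n)%N -> `|F k| <= c) -> `|\sum_(k < n) F k| <= n%:R * c.
Proof.
move=> Fc; apply: (le_trans (ler_norm_sum _ _ _)).
rewrite mulr_natl -[n in leRHS]card_ord -sumr_const.
by apply: ler_sum => k _; exact: Fc.
Qed.

Lemma near_infty_divn_le (R : realType) (a e : R) : 0 < e ->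
  \forall n \near \oo, a / n.+1%:R <= e.
Proof.
move=> e0; have : (a * harmonic n) @[n --> \oo] --> a * (0 : R).
  by apply: cvgMl_tmp; exact: cvg_harmonic.
by rewrite mulr0 => /cvgr_le; exact.
Qed.

(** * Orbit means and the generator of a contraction semigroup *)

Section ContractionSemigroup.
Context {R : realType} {X : completeNormedModType R}.
Variable T : R -> {linear X -> X}.
Hypothesis hT : C0_semigroup T.
Hypothesis cT : forall t, 0 <= t -> forall x, `|T t x| <= `|x|.

Lemma semigroup0 x : T 0 x = x.
Proof. by case: hT. Qed.

Lemma semigroupD s t x : 0 <= s -> 0 <= t -> T (s + t) x = T s (T t x).
Proof. by case: hT => _ TD _ s0 t0; exact: TD. Qed.

Lemma semigroup_near0 x e : 0 < e ->
  exists2 d, 0 < d & forall s, 0 <= s <= d -> `|T s x - x| <= e.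
Proof.
move=> e0; case: hT => T0 _ /(_ x) /cvgr0Pnorm_le /(_ e e0) /near0_right_ex.
move=> [d d0 Td]; exists d => // s /andP[].
rewrite le_eqVlt => /predU1P[<- _|s0 sd]; first by rewrite T0 subrr normr0 ltW.
by rewrite -[leLHS]normr_id; apply: Td; rewrite s0.
Qed.

Lemma semigroup_dist x s t : 0 <= s <= t ->
  `|T t x - T s x| <= `|T (t - s) x - x|.
Proof.
move=> /andP[s0 st]; have ts : 0 <= t - s by rewrite subr_ge0.
by have := semigroupD x s0 ts; rewrite subrKC => ->; rewrite -linearB; exact: cT.
Qed.

(** A left Riemann sum for the time average of the orbit of [x] over an interval of length
    [h * n%:R]. *)
Definition orbit_mean (h : R) (n : nat) (x : X) : X :=
  n%:R^-1 *: \sum_(k < n) T (h * k%:R) x.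

Lemma orbit_mean_norm h n x : 0 <= h -> `|orbit_mean h n x| <= `|x|.
Proof.
move=> h0; rewrite normrZ normfV normr_nat.
have [->|n0] := posnP n; first by rewrite invr0 mul0r.
rewrite ler_pdivrMl ?ltr0n //; apply: (@norm_sum_le _ _ _ (fun k => T (h * k%:R) x)).
by move=> k _; apply: cT; rewrite mulr_ge0.
Qed.

Lemma orbit_meanB h n x y :
  orbit_mean h n (x - y) = orbit_mean h n x - orbit_mean h n y.
Proof.
rewrite -scalerBr -sumrB; congr (_ *: _).
by apply: eq_bigr => k _; rewrite linearB.
Qed.

Lemma orbit_mean_dist h n x e : (0 < n)%N -> 0 <= h ->
  (forall s, 0 <= s <= h * n%:R -> `|T s x - x| <= e) ->
  `|orbit_mean h n x - x| <= e.
Proof.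
move=> n0 h0 Te.
have nV : n%:R != 0 :> R by rewrite pnatr_eq0 -lt0n.
have -> : orbit_mean h n x - x = n%:R^-1 *: \sum_(k < n) (T (h * k%:R) x - x).
  rewrite sumrB scalerBr sumr_const card_ord -[x *+ n]scaler_nat scalerA mulVf //.
  by rewrite scale1r.
rewrite normrZ normfV normr_nat ler_pdivrMl ?ltr0n //.
apply: (@norm_sum_le _ _ _ (fun k => T (h * k%:R) x - x)) => k kn; apply: Te.
by rewrite mulr_ge0 //= ler_wpM2l // ler_nat ltnW.
Qed.

(** Indices below [n * m] are split as [i * m + j], and the semigroup law factors the corresponding
    times. This compares a mesh with its refinement. *)
Lemma orbit_mean_refine h n m x : 0 <= h -> (0 < m)%N ->
  orbit_mean h (n * m) x = orbit_mean (h * m%:R) n (orbit_mean h m x).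
Proof.
move=> h0 m0; rewrite /orbit_mean natrM invfM -scalerA; congr (_ *: _).
under [RHS]eq_bigr do rewrite linearZ /= linear_sum /=.
rewrite -scaler_sumr; congr (_ *: _).
rewrite -(big_mkord xpredT (fun k => T (h * k%:R) x)) big_nat_mul big_mkord.
apply: eq_bigr => i _; rewrite -{1}[(i * m)%N]add0n mulSn big_addn addnK big_mkord.
apply: eq_bigr => j _; rewrite -semigroupD ?mulr_ge0 //.
by congr (T _ x); rewrite natrD natrM; ring.
Qed.

(* Telescoping: up to the mesh, this is the identity
   (T_r - I) int_0^c T_s x ds = int_0^r T_s (T_c - I) x ds with c = h n, r = h j *)
Lemma orbit_mean_shift h n j x : 0 <= h ->
  T (h * j%:R) (orbit_mean h n x) - orbit_mean h n x =
  n%:R^-1 *: \sum_(k < j) T (h * k%:R) (T (h * n%:R) x - x).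
Proof.
move=> h0; rewrite /orbit_mean linearZ /= linear_sum -scalerBr; congr (_ *: _).
pose a k := T (h * k%:R) x.
have aD i k : T (h * i%:R) (a k) = a (i + k)%N.
  by rewrite /a -semigroupD ?mulr_ge0 // natrD mulrDr.
have sumE i k : \sum_(l < i) a (k + l)%N =
    \sum_(0 <= l < k + i) a l - \sum_(l < k) a l.
  rewrite (big_cat_nat (n := k)) ?leq_addr //= big_mkord addrC addrK.
  rewrite -{2}[k]add0n big_addn addKn big_mkord.
  by apply: eq_bigr => l _; rewrite addnC.
transitivity (\sum_(l < n) a (j + l)%N - \sum_(l < n) a l).
  by congr (_ - _); apply: eq_bigr => l _; exact: aD.
transitivity (\sum_(l < j) a (n + l)%N - \sum_(l < j) a l).
  by rewrite !sumE addnC addrAC.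
by rewrite -sumrB; apply: eq_bigr => l _; rewrite linearB /= -/(a n) aD addnC.
Qed.

(** Two meshes are compared through their common refinement. Since means are contractions, refining
    costs at most the displacement of [x] during one coarse step. *)
Lemma is_cvg_orbit_mean c x : 0 < c ->
  cvgn (fun n => orbit_mean (c / n.+1%:R) n.+1 x).
Proof.
move=> c0; apply/cauchy_cvgP; apply: cauchy_exP => e e0.
have e2 : 0 < e / 3 by rewrite divr_gt0.
have [d d0 Td] := semigroup_near0 x e2.
have refine n m : c / n.+1%:R <= d ->
    `|orbit_mean (c / n.+1%:R) n.+1 x -
      orbit_mean (c / (n.+1 * m.+1)%:R) (n.+1 * m.+1) x| <= e / 3.
  move=> cd; have h0 : 0 <= c / (n.+1 * m.+1)%:R :> R by rewrite divr_ge0 // ltW.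
  have hm : c / (n.+1 * m.+1)%:R * m.+1%:R = c / n.+1%:R :> R.
    by rewrite natrM invfM mulrA mulfVK // pnatr_eq0.
  rewrite orbit_mean_refine // hm -orbit_meanB.
  apply: le_trans (orbit_mean_norm _ _ _) _; first by rewrite divr_ge0 // ltW.
  rewrite distrC; apply: orbit_mean_dist => // s /andP[s0].
  by rewrite hm => sh; apply: Td; rewrite s0 (le_trans sh).
have small := near_infty_divn_le c d0.
near \oo => n; exists (orbit_mean (c / n.+1%:R) n.+1 x).
change (\forall m \near \oo, ball (orbit_mean (c / n.+1%:R) n.+1 x) e
  (orbit_mean (c / m.+1%:R) m.+1 x)).
near=> m; rewrite -ball_normE /=.
rewrite -(subrKA (orbit_mean (c / (n.+1 * m.+1)%:R) (n.+1 * m.+1) x)).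
apply: (le_lt_trans (ler_normD _ _)).
have H1 := refine n m; have H2 := refine m n.
rewrite mulnC distrC in H2.
apply: (@le_lt_trans _ _ (e / 3 + e / 3)); last by lra.
by apply: lerD; [apply: H1; near: n | apply: H2; near: m].
Unshelve. all: by end_near. Qed.

(** Limit form of [orbit_mean_shift]: [T r y - y] is 1/c times the integral of [T s w] over times s
    from 0 to [r], where the integrand stays within [e] of [w]. *)
Lemma orbit_mean_diff_quotient c x r e :
  let y := limn (fun n => orbit_mean (c / n.+1%:R) n.+1 x) in
  let w := T c x - x in
  0 < c -> 0 <= r -> (forall s, 0 <= s <= r -> `|T s w - w| <= e) ->
  `|T r y - y - (r / c) *: w| <= r / c * e.
Proof.
move=> y w c0 r0 Te; apply/ler_addgt0Pr => eta eta0.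
have eta4 : 0 < eta / 4 by rewrite divr_gt0.
have [d d0 Td] := semigroup_near0 y eta4.
have yn := is_cvg_orbit_mean (x := x) c0.
near \oo => n.
have yny : `|y - orbit_mean (c / n.+1%:R) n.+1 x| <= eta / 4.
  by near: n; exact: cvgr_dist_le.
have hd : c / n.+1%:R <= d by near: n; exact: near_infty_divn_le.
have wn : `|w| / n.+1%:R <= eta / 4 by near: n; exact: near_infty_divn_le.
(* The last mesh point not after [r] is [h * j%:R]; dividing it by [c] gives the approximation [p]
   of [r / c]. *)
pose h := c / n.+1%:R; pose j := Num.truncn (r / h); pose yn' := orbit_mean h n.+1 x.
have h0 : 0 < h by rewrite divr_gt0.
have /andP[jr rj] : h * j%:R <= r < h * j%:R + h.
  have := truncn_itv (divr_ge0 r0 (ltW h0)).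
  by rewrite ler_pdivlMr // ltr_pdivrMr // -natr1 mulrDl mul1r ![_ * h]mulrC.
have nn : n.+1%:R != 0 :> R by rewrite pnatr_eq0.
have hh : h != 0 by rewrite gt_eqF.
have hn : h * n.+1%:R = c by rewrite mulfVK.
have jn : n.+1%:R^-1 * j%:R = h * j%:R / c.
  by rewrite -hn invfM mulrACA divff // mul1r mulrC.
set p := h * j%:R / c in jn.
have pr : `|p - r / c| <= 1 / n.+1%:R.
  have -> : 1 / n.+1%:R = h / c by rewrite -hn invfM mulrA divff.
  rewrite distrC -mulrBl normrM (gtr0_norm (x := c^-1)) ?invr_gt0 //.
  rewrite ler_pM2r ?invr_gt0 // ger0_norm; lra.
(* The hypothesis [Te] at time 0 forces [0 <= e]. *)
have pe : p * e <= r / c * e.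
  apply: ler_wpM2r; last by rewrite /p ler_pM2r // invr_gt0.
  by apply: le_trans (Te 0 _); rewrite ?lexx.
rewrite -addrA -opprD.
(* The four intermediate points leave five gaps: four are at most [eta / 4], and the one between
   [T (h * j%:R) yn'] and [yn' + p *: w] is at most [p * e]. *)
have := ler_distD (T (h * j%:R) y) (T r y) (y + (r / c) *: w).
have := ler_distD (T (h * j%:R) yn') (T (h * j%:R) y) (y + (r / c) *: w).
have := ler_distD (yn' + p *: w) (T (h * j%:R) yn') (y + (r / c) *: w).
have := ler_distD (y + p *: w) (yn' + p *: w) (y + (r / c) *: w).
have hj0 : 0 <= h * j%:R by rewrite mulr_ge0 // ltW.
have E1 : `|T r y - T (h * j%:R) y| <= eta / 4.
  apply: (le_trans (semigroup_dist _ _)); first by rewrite hj0.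
  apply: Td; rewrite subr_ge0 jr /=.
  by apply: le_trans hd; rewrite -/h; lra.
have E2 : `|T (h * j%:R) y - T (h * j%:R) yn'| <= eta / 4.
  by rewrite -linearB; exact: le_trans (cT _ _) yny.
have E3 : `|T (h * j%:R) yn' - (yn' + p *: w)| <= p * e.
  rewrite opprD addrA orbit_mean_shift ?(ltW h0) // hn -/w -jn.
  have -> : n.+1%:R^-1 *: (\sum_(k < j) T (h * k%:R) w) - (n.+1%:R^-1 * j%:R) *: w =
      n.+1%:R^-1 *: (\sum_(k < j) (T (h * k%:R) w - w)).
    by rewrite -scalerA -scalerBr sumrB sumr_const card_ord scaler_nat.
  rewrite normrZ normfV normr_nat -mulrA ler_wpM2l //.
  apply: (@norm_sum_le _ _ _ (fun k => T (h * k%:R) w - w)) => k kj; apply: Te.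
  rewrite mulr_ge0 ?(ltW h0) //=; apply: le_trans jr.
  by rewrite ler_wpM2l ?(ltW h0) // ler_nat ltnW.
have E4 : `|yn' + p *: w - (y + p *: w)| <= eta / 4.
  by rewrite opprD addrACA subrr addr0 distrC.
have E5 : `|y + p *: w - (y + (r / c) *: w)| <= eta / 4.
  rewrite opprD addrACA subrr add0r -scalerBl normrZ.
  apply: (@le_trans _ _ (1 / n.+1%:R * `|w|)); first exact: ler_wpM2r.
  by rewrite mulrAC mul1r.
lra.
Unshelve. all: by end_near. Qed.

(** The limiting orbit mean over a time [c] lies in the domain, with generator value
    [c^-1 *: (T c x - x)]; it is close to [x] when the orbit has moved little up to time [c]. *)
Lemma generator_dom_dense x e : 0 < e ->
  exists2 y, generator_dom T y & `|x - y| <= e.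
Proof.
move=> e0; have [c c0 Tc] := semigroup_near0 x e0.
have yn := is_cvg_orbit_mean (x := x) c0.
exists (limn (fun n => orbit_mean (c / n.+1%:R) n.+1 x)).
  apply: (@cvgP _ _ (c^-1 *: (T c x - x))); apply/cvgrPdist_le => eps eps0.
  (* The tolerance [eps * c] cancels the factor 1/c in [orbit_mean_diff_quotient]. *)
  have [d d0 Td] := semigroup_near0 (T c x - x) (mulr_gt0 eps0 c0).
  apply: (near0_right_intro d0) => r /andP[r0 rd].
  rewrite distrC /diff_quotient.
  rewrite -[c^-1](mulKf (lt0r_neq0 r0)) -scalerA -scalerBr.
  rewrite normrZ gtr0_norm ?invr_gt0 // ler_pdivrMl //.
  apply: le_trans (orbit_mean_diff_quotient c0 (ltW r0) (e := eps * c) _) _.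
    by move=> s /andP[s0 sr]; apply: Td; rewrite s0 (le_trans sr).
  by rewrite mulrA mulrAC mulfVK ?gt_eqF // mulrC.
apply: (@cvgr_to_le _ \oo _ _ (fun n => `|x - orbit_mean (c / n.+1%:R) n.+1 x|)).
  exact: cvg_norm (cvgB (cvg_cst x) yn).
near=> n; rewrite distrC; apply: orbit_mean_dist => //.
  by rewrite divr_ge0 // ltW.
by rewrite mulfVK ?pnatr_eq0.
Unshelve. all: by end_near. Qed.

(** [T t] commutes with the difference quotients and is a contraction, so it carries their limit
    along. *)
Lemma generator_dom_semigroup t x : 0 <= t ->
  generator_dom T x -> generator_dom T (T t x).
Proof.
move=> t0 /cvg_ex[l xl]; apply: (@cvgP _ _ (T t l)).
apply/cvgrPdist_le => e e0; move/cvgrPdist_le: xl => /(_ e e0) /near0_right_ex.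
move=> [d d0 xd]; apply: (near0_right_intro d0) => s /andP[s0 sd].
have -> : diff_quotient T (T t x) s = T t (diff_quotient T x s).
  rewrite /diff_quotient linearZ; congr (_ *: _); rewrite linearB.
  by rewrite -(semigroupD x (ltW s0) t0) -(semigroupD x t0 (ltW s0)) (addrC s).
by rewrite -linearB; apply: le_trans (cT _ _) _ => //; apply: xd; rewrite s0.
Qed.

Lemma generator_near0 x e : generator_dom T x -> 0 < e ->
  exists2 d, 0 < d & forall h, 0 < h <= d ->
    `|T h x - x - h *: generator T x| <= h * e.
Proof.
move=> xD e0; have := xD; move/cvgrPdist_le => /(_ e e0) /near0_right_ex.
move=> [d d0 xd]; exists d => // h /andP[h0 hd].
rewrite -ler_pdivrMl // -[X in X * _]gtr0_norm ?invr_gt0 // -normrZ scalerBr.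
by rewrite scalerA mulVf ?gt_eqF // scale1r distrC; apply: xd; rewrite h0.
Qed.

End ContractionSemigroup.

(** * Linear-in-time distance between two semigroups whose generators differ by [B] *)

Section BoundedPerturbation.
Context {R : realType} {X : completeNormedModType R}.
Variables (S T : R -> {linear X -> X}) (B : {linear X -> X}).
Hypotheses (hS : C0_semigroup S) (hT : C0_semigroup T).
Hypothesis cS : forall t, 0 <= t -> forall x, `|S t x| <= `|x|.
Hypothesis cT : forall t, 0 <= t -> forall x, `|T t x| <= `|x|.
Hypothesis hdom : generator_dom S = generator_dom T.
Hypothesis hB : bounded_near B (nbhs (0 : X)).
Hypothesis hBgen :
  forall x, generator_dom S x -> B x = generator T x - generator S x.

(** With [y := S s x], the difference at time [s + h] splits into [T h (T s x) - T h y], controlled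
    by contraction, and [T h y - S h y], which is [h *: B y] up to o(h) because [y] stays in the
    common domain. *)
Lemma semigroup_perturbation_dom t x : 0 <= t -> generator_dom S x ->
  `|T t x - S t x| <= t * (opnorm B * `|x|).
Proof.
move=> t0 xD; have [B0 Ble] := opnorm_linear hB.
have := @le_of_right_derivative_le _ (fun s => `|T s x - S s x|)
  (opnorm B * `|x|) t (mulr_ge0 B0 (normr_ge0 x)) t0.
rewrite (semigroup0 hS) (semigroup0 hT) subrr normr0 add0r; apply.
- move=> s e s0 e0; have yD := generator_dom_semigroup hS cS s0 xD.
  have e2 : 0 < e / 2 by rewrite divr_gt0.
  have [d1 d10 Sd] := generator_near0 yD e2.
  have yDT := yD; rewrite hdom in yDT.
  have [d2 d20 Td] := generator_near0 yDT e2.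
  exists (Num.min d1 d2); first by rewrite lt_min d10.
  move=> h /andP[h0]; rewrite le_min => /andP[hd1 hd2].
  rewrite [s + h]addrC (semigroupD hS) ?(semigroupD hT) ?(ltW h0) //.
  set y := S s x in yD yDT Sd Td *.
  have dT : `|T h (T s x) - T h y| <= `|T s x - y|.
    by rewrite -linearB; apply: cT; rewrite ltW.
  have dTS : `|T h y - S h y| <= h * (opnorm B * `|x| + e).
    have E1 := Sd h; have E2 := Td h.
    rewrite h0 hd1 in E1; rewrite h0 hd2 in E2.
    have {}E1 := E1 isT; have {}E2 := E2 isT.
    have E3 : `|h *: B y| <= h * (opnorm B * `|x|).
      rewrite normrZ gtr0_norm // ler_wpM2l ?(ltW h0) //.
      by apply: le_trans (Ble _) _; apply: ler_wpM2l => //; exact: cS.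
    have -> : T h y - S h y = (T h y - y - h *: generator T y) + h *: B y -
        (S h y - y - h *: generator S y).
      rewrite hBgen // scalerBr [_ - _ *: generator T y + _]addrA subrK.
      by rewrite opprB addrA subrK opprB addrA subrK.
    apply: (le_trans (ler_normB _ _)); have := ler_normD
      (T h y - y - h *: generator T y) (h *: B y); lra.
  by have := ler_distD (T h y) (T h (T s x)) (S h y); lra.
(* Semicontinuity from the left: [semigroup_dist] reduces it to strong continuity at time 0. *)
- move=> s e s0 e0.
  have e2 : 0 < e / 2 by rewrite divr_gt0.
  have [d1 d10 Sd] := semigroup_near0 hS x e2.
  have [d2 d20 Td] := semigroup_near0 hT x e2.
  exists (Num.min d1 d2); first by rewrite lt_min d10.
  move=> r /andP[r0 rs]; rewrite lerBlDl -lerBlDr le_min => /andP[rd1 rd2].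
  have rs' : 0 <= r <= s by rewrite r0.
  have E1 : `|S s x - S r x| <= e / 2.
    apply: le_trans (semigroup_dist hS cS _ rs') _.
    by apply: Sd; rewrite subr_ge0 rs.
  have E2 : `|T s x - T r x| <= e / 2.
    apply: le_trans (semigroup_dist hT cT _ rs') _.
    by apply: Td; rewrite subr_ge0 rs.
  have := ler_distD (T r x) (T s x) (S s x).
  have := ler_distD (S r x) (T r x) (S s x).
  rewrite (distrC (S r x)); lra.
Qed.

Lemma semigroup_perturbation t x : 0 <= t ->
  `|T t x - S t x| <= t * (opnorm B * `|x|).
Proof.
move=> t0; have [B0 _] := opnorm_linear hB.
(* Replacing [x] by a domain element [y] costs their distance twice, and [t * opnorm B] times that
   distance through the norm of [y]. *)
have K0 : 0 < 2 + t * opnorm B by have := mulr_ge0 t0 B0; lra.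
apply/ler_addgt0Pr => e e0.
have [y yD xy] := generator_dom_dense hS cS x (divr_gt0 e0 K0).
have E1 := semigroup_perturbation_dom t0 yD.
have E2 : `|T t x - T t y| <= `|x - y| by rewrite -linearB; exact: cT.
have E3 : `|S t y - S t x| <= `|x - y| by rewrite -linearB distrC; exact: cS.
have E4 : `|y| <= `|x| + `|x - y|.
  by have := ler_normB x (x - y); rewrite subKr.
have E5 : (2 + t * opnorm B) * `|x - y| <= e by rewrite -ler_pdivlMl // mulrC.
have E6 := ler_wpM2l (mulr_ge0 t0 B0) E4.
have := ler_distD (T t y) (T t x) (S t x).
have := ler_distD (S t y) (T t y) (S t x).
lra.
Qed.

End BoundedPerturbation.

(** * Geometric convergence of a Markov semigroup under the Dobrushin condition *)

Section MarkovSemigroups.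
Context {R : realType} {X : completeNormedModType R}.
Variables (P : set X) (f : {scalar X}).
Hypothesis hX : abstract_state_space P f.
Variable T : R -> {linear X -> X}.
Hypothesis hT : C0_markov_semigroup P f T.
Variables (rho t0 : R).
Hypotheses (rho_ge0 : 0 <= rho) (rho_lt1 : rho < 1) (t0_gt0 : 0 < t0).
Hypothesis hdelta : dobrushin f (T t0) <= rho.

Lemma markov_semigroup_contraction t : 0 <= t -> forall x, `|T t x| <= `|x|.
Proof. by move=> ht x; apply: (markov_contraction hX); case: hT => _; exact. Qed.

Lemma markov_semigroup_functional t x : 0 <= t -> f (T t x) = f x.
Proof. by move=> ht; apply: (markov_functional hX); case: hT => _; exact. Qed.

Lemma markov_semigroup_base t x : 0 <= t -> base P f x -> base P f (T t x).
Proof. by move=> ht; case: hT => _ /(_ t ht)[_]; exact. Qed.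

Lemma dobrushin_step u : f u = 0 -> `|T t0 u| <= rho * `|u|.
Proof.
move=> fu; apply: (@le_trans _ _ (dobrushin f (T t0) * `|u|)).
  by apply: (dobrushin_bound hX) => //; case: hT => _; apply; exact: ltW.
exact: ler_wpM2r.
Qed.

(** The semigroup keeps the kernel of [f] invariant, so the factor [rho] is gained at every step of
    length [t0]; the leftover time is merely contractive. *)
Lemma dobrushin_power n t u : f u = 0 -> n%:R * t0 <= t ->
  `|T t u| <= rho ^+ n * `|u|.
Proof.
elim: n t => [|n IHn] t fu nt.
  by rewrite expr0 mul1r; apply: markov_semigroup_contraction; rewrite mul0r in nt.
have {}nt : n%:R * t0 <= t - t0 by move: nt; rewrite -natr1; lra.
have tt0 : 0 <= t - t0 by apply: le_trans nt; rewrite mulr_ge0 // ltW.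
have [hT0 _] := hT; have := semigroupD hT0 u (ltW t0_gt0) tt0.
rewrite subrKC => ->; apply: (le_trans (dobrushin_step _)).
  by rewrite markov_semigroup_functional.
by rewrite exprS -mulrA ler_wpM2l // IHn.
Qed.

Lemma base_dist x y : base P f x -> base P f y -> `|x - y| <= 2.
Proof.
move=> /(base_norm hX) x1 /(base_norm hX) y1.
by have := ler_normB x y; rewrite x1 y1; lra.
Qed.

(* Both points lie in the image of K under T_(n t0), which has diameter at
   most 2 rho^n *)
Lemma orbit_base_dist n s t x y : base P f x -> base P f y ->
  n%:R * t0 <= s -> n%:R * t0 <= t -> `|T s x - T t y| <= rho ^+ n * 2.
Proof.
move=> Kx Ky ns nt; have nt0 : 0 <= n%:R * t0 by rewrite mulr_ge0 // ltW.
have s0 : 0 <= s - n%:R * t0 by rewrite subr_ge0.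
have s0' : 0 <= t - n%:R * t0 by rewrite subr_ge0.
have [hT0 _] := hT.
have := semigroupD hT0 x nt0 s0; have := semigroupD hT0 y nt0 s0'.
rewrite !subrKC => -> ->; rewrite -linearB.
have [Kx' Ky'] := (markov_semigroup_base s0 Kx, markov_semigroup_base s0' Ky).
apply: (le_trans (dobrushin_power (n := n) _ (lexx _))).
  by rewrite linearB; case: Kx' Ky' => _ /= -> [_ /= ->]; rewrite subrr.
by rewrite ler_wpM2l ?exprn_ge0 // base_dist.
Qed.

(** [orbit_base_dist] makes [u] a Cauchy sequence, and sending its second time to infinity gives the
    rate. Uniformity over the base is what later yields convergence in operator norm. *)
Lemma stationary_state_rate :
  exists2 x0, base P f x0 & forall n t x, base P f x -> n%:R * t0 <= t ->
    `|T t x - x0| <= rho ^+ n * 2.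
Proof.
have [k Kk] := base_nonempty hX.
pose u n := T (n%:R * t0) k.
have nm n m : (n <= m)%N -> n%:R * t0 <= m%:R * t0.
  by move=> lenm; rewrite ler_pM2r // ler_nat.
have ucv : cvgn u.
  apply/cauchy_cvgP; apply: cauchy_exP => e e0.
  have : (rho ^+ n * 2) @[n --> \oo] --> (0 * 2 : R).
    by apply: cvgMr_tmp; apply: cvg_expr; rewrite ger0_norm.
  rewrite mul0r => /cvgr_lt/(_ e e0)[n _ small]; exists (u n).
  exists n => // m /= lenm; rewrite -ball_normE /=.
  apply: le_lt_trans (small n (leqnn _)).
  exact: orbit_base_dist (nm _ _ lenm).
exists (limn u).
  apply: (closed_cvg (base P f) (closed_base hX) _ _ ucv).
  by near=> n; apply: markov_semigroup_base => //; rewrite mulr_ge0 // ltW.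
move=> n t x Kx nt.
apply: (@cvgr_to_le _ \oo _ _ (fun m => `|T t x - u m|)).
  exact: cvg_norm (cvgB (cvg_cst _) ucv).
exists n => // m /= lenm; exact: orbit_base_dist (nm _ _ lenm).
Unshelve. all: by end_near. Qed.

Lemma rank1_bound x0 x : base P f x0 -> `|rank1 f x0 x| <= `|x|.
Proof.
move=> /(base_norm hX) x01; rewrite normrZ x01 mulr1.
exact: state_functional_le hX x.
Qed.

Lemma uniformly_stable_exists : exists x0, uniformly_stable_to P f T x0.
Proof.
have [x0 Kx0 rate] := stationary_state_rate.
exists x0; split => //; apply/cvgr0Pnorm_le => e e0.
have : (rho ^+ n * 2) @[n --> \oo] --> (0 * 2 : R).
  by apply: cvgMr_tmp; apply: cvg_expr; rewrite ger0_norm.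
rewrite mul0r => /cvgr_le/(_ e e0)[n _ /(_ n (leqnn _)) small].
near=> t.
have nt : n%:R * t0 <= t by near: t; apply: nbhs_pinfty_ge; rewrite num_real.
(* On the base [rank1 f x0] is constantly [x0], so the rate there extends to all of X by
   [base_seminorm_le]. *)
have Trate x : `|T t x - rank1 f x0 x| <= rho ^+ n * 2 * `|x|.
  apply: (base_seminorm_le hX (q := fun x => `|T t x - rank1 f x0 x|)).
  - by rewrite mulr_ge0 // exprn_ge0.
  - by move=> l y; rewrite /rank1 !linearZ /= -scalerA -scalerDr normrZ.
  - move=> y z; rewrite /rank1 !linearD /= scalerDl opprD addrACA.
    exact: ler_normD.
  - by move=> y Ky; rewrite /rank1 (proj2 Ky) scale1r; exact: rate.
have ball1 x : `|x| <= 1 -> `|T t x - rank1 f x0 x| <= rho ^+ n * 2.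
  move=> x1; apply: (le_trans (Trate x)).
  by rewrite ler_piMr // mulr_ge0 // exprn_ge0.
rewrite ger0_norm; first exact: le_trans (opnorm_le ball1) small.
by apply: le_trans (opnorm_ub ball1 (x := 0) _); rewrite ?normr0.
Unshelve. all: by end_near. Qed.

End MarkovSemigroups.

(** Base elements have norm 1 and are sent to [x0] by [rank1 f x0]. Such orbit limits give both the
    uniqueness of [x0] and its comparison with [z0]. *)
Lemma uniformly_stable_cvg (R : realType) (X : completeNormedModType R)
    (P : set X) (f : {scalar X}) (T : R -> {linear X -> X}) (x0 x : X) :
  abstract_state_space P f -> C0_markov_semigroup P f T ->
  uniformly_stable_to P f T x0 -> base P f x ->
  T t x @[t --> +oo] --> x0.
Proof.
move=> hX hT [Kx0 st] Kx; apply/cvgrPdist_le => e e0.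
move/cvgr0Pnorm_le: st => /(_ e e0) st; near=> t.
have t_ge0 : 0 <= t by near: t; apply: nbhs_pinfty_ge; rewrite num_real.
have -> : x0 - T t x = - (T t x - rank1 f x0 x).
  by rewrite opprB /rank1 (proj2 Kx) scale1r.
rewrite normrN.
(* The crude bound 2 only ensures that the supremum in [opnorm] is a genuine one. *)
have ball1 y : `|y| <= 1 -> `|T t y - rank1 f x0 y| <= 2.
  move=> y1; have := ler_normB (T t y) (rank1 f x0 y).
  have := rank1_bound hX y Kx0.
  have := markov_semigroup_contraction hX hT t_ge0 y; lra.
apply: (@le_trans _ _ (opnorm (fun x => T t x - rank1 f x0 x))).
  by apply: (opnorm_ub ball1); rewrite (base_norm hX Kx).
apply: (le_trans (ler_norm _)).
by near: t.
Unshelve. all: by end_near. Qed.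

(** * Uniform-in-time stability of orbits and stationary states *)

Theorem corollary3p7 (R : realType) (X : completeNormedModType R)
    (P : set X) (f : {scalar X})
    (hX : abstract_state_space P f)
    (S T : R -> {linear X -> X})
    (hS : C0_markov_semigroup P f S) (hT : C0_markov_semigroup P f T)
    (hdom : generator_dom S = generator_dom T)
    (B : {linear X -> X}) (hB : bounded_near B (nbhs (0 : X)))
    (hBgen : forall x, generator_dom S x -> B x = generator T x - generator S x)
    (rho t0 : R) (hrho0 : 0 <= rho) (hrho1 : rho < 1) (ht0 : 0 < t0)
    (hdelta : dobrushin f (T t0) <= rho) :
  [/\ (forall x z, base P f x -> base P f z ->
        (ereal_sup [set (`|T t x - S t z|%R)%:E | t in [set t : R | (0 <= t)%R]]
           <= (`|x - z| + t0 / (1 - rho) * opnorm B)%R%:E)%E),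
      (exists! x0 : X, uniformly_stable_to P f T x0) &
      (forall x0 z0,
        uniformly_stable_to P f T x0 -> uniformly_stable_to P f S z0 ->
        opnorm (fun x => rank1 f x0 x - rank1 f z0 x)
          <= t0 / (1 - rho) * opnorm B)].
Proof.
have cS := markov_semigroup_contraction hX hS.
have cT := markov_semigroup_contraction hX hT.
have [hS0 _] := hS; have [hT0 _] := hT.
have B0 : 0 <= opnorm B by have [] := opnorm_linear hB.
have rho1 : 0 < 1 - rho by rewrite subr_gt0.
set E := t0 / (1 - rho) * opnorm B.
have EE : rho * E + t0 * opnorm B = E by rewrite /E; field; rewrite gt_eqF.
have TB : t0 * opnorm B <= E.
  by rewrite -EE lerDr mulr_ge0 // /E mulr_ge0 // divr_ge0 // ltW.
have pert z t : base P f z -> 0 <= t -> `|T t z - S t z| <= t * opnorm B.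
  move=> /(base_norm hX) z1 t_ge0.
  have := semigroup_perturbation hS0 hT0 cS cT hdom hB hBgen z t_ge0.
  by rewrite z1 mulr1.
have TS z t : base P f z -> 0 <= t -> `|T t z - S t z| <= E.
  move=> Kz t_ge0.
  (* Induction on the number of steps of length [t0]; the successor of the integer part of [t / t0]
     is enough of them to reach [t]. *)
  suff TSn n : forall t, 0 <= t <= n%:R * t0 -> `|T t z - S t z| <= E.
    apply: (TSn (Num.truncn (t / t0)).+1); rewrite t_ge0 /= -ler_pdivrMr // ltW //.
    by have /andP[] := truncn_itv (divr_ge0 t_ge0 (ltW ht0)).
  elim: n => [|n IHn] {t_ge0}t /andP[t_ge0 tn].
    apply: le_trans TB; apply: (le_trans (pert _ _ Kz t_ge0)).
    by apply: ler_wpM2r => //; apply: le_trans tn _; rewrite mul0r ltW.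
  have [tt0|tt0] := leP t t0.
    by apply: le_trans TB; apply: (le_trans (pert _ _ Kz t_ge0)); exact: ler_wpM2r.
  have s0 : 0 <= t - t0 by rewrite subr_ge0 ltW.
  have sn : t - t0 <= n%:R * t0 by move: tn; rewrite -natr1; lra.
  have := semigroupD hS0 z (ltW ht0) s0; have := semigroupD hT0 z (ltW ht0) s0.
  rewrite subrKC => -> ->.
  (* The first difference is the image under [T t0] of a kernel element of norm at most [E], hence
     at most [rho * E]; the second compares the semigroups over time [t0] from a base point. *)
  apply: (le_trans (ler_distD (T t0 (S (t - t0) z)) _ _)).
  rewrite -EE -linearB; apply: lerD; last first.
    by apply: pert; [exact: markov_semigroup_base hS _ _ s0 Kz | exact: ltW].
  apply: (le_trans (dobrushin_step hX hT ht0 hdelta _)).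
    rewrite linearB /= (markov_semigroup_functional hX hT) //.
    by rewrite (markov_semigroup_functional hX hS) // subrr.
  by apply: ler_wpM2l => //; apply: IHn; rewrite s0.
split.
- move=> x z Kx Kz; apply: ge_ereal_sup => _ [t /= t_ge0 <-]; rewrite lee_fin.
  apply: (le_trans (ler_distD (T t z) _ _)); apply: lerD; last exact: TS.
  by rewrite -linearB; exact: cT.
- have [x0 stx0] := uniformly_stable_exists hX hT hrho0 hrho1 ht0 hdelta.
  exists x0; split => // y sty; have [k Kk] := base_nonempty hX.
  exact: cvg_unique (uniformly_stable_cvg hX hT stx0 Kk)
    (uniformly_stable_cvg hX hT sty Kk).
- move=> x0 z0 stx stz; have [k Kk] := base_nonempty hX.
  (* The time-uniform bound [E] passes to the limit along the two orbits of one base point. *)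
  have x0z0 : `|x0 - z0| <= E.
    apply: (@cvgr_to_le _ +oo _ _ (fun t => `|T t k - S t k|)).
      exact: cvg_norm (cvgB (uniformly_stable_cvg hX hT stx Kk)
        (uniformly_stable_cvg hX hS stz Kk)).
    by near=> t; apply: TS => //; near: t; apply: nbhs_pinfty_ge;
      rewrite num_real.
  apply: opnorm_le => x x1; rewrite /rank1 -scalerBr normrZ.
  apply: le_trans x0z0; apply: ler_piMl => //.
  exact: le_trans (state_functional_le hX x) x1.
Unshelve. all: by end_near. Qed.
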